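(* Let $M$ be a left $R$-module that is projective in $\sigma[M]$, and let $S=\mathrm{End}_R(M)$. Suppose that $M$ is a continuous, retractable, non $M$-singular module and satisfies ACC on annihilators. Then $M$ is a semiprime Goldie module.
   Context: $R$ is an associative ring with unity; modules are unitary left $R$-modules; modules under consideration are nonzero. For a left $R$-module $M$, a module $X$ is $M$-generated if it is an epimorphic image of a direct sum of copies of $M$, and $\sigma[M]$ is the full subcategory of left $R$-modules isomorphic to a submodule of an $M$-generated module. $M$ is projective in $\sigma[M]$ if $\mathrm{Hom}_R(M,-)$ is exact on short exact sequences in $\sigma[M]$. $M$ is continuous if (C1) every submodule of $M$ is essential in a direct summand of $M$, and (C2) every submodule of $M$ that is isomorphic to a direct summand of $M$ is itself a direct summand. $M$ is retractable if $\mathrm{Hom}_R(M,N)\neq 0$ for all $0\neq N\subseteq M$. A module $N\in\sigma[M]$ is $M$-singular if there is an exact sequence $0\to K\to L\to N\to 0$ in $\sigma[M]$ with $K$ essential in $L$; every $L\in\sigma[M]$ has a largest $M$-singular submodule $\mathcal{Z}(L)$, and $L$ is non $M$-singular if $\mathcal{Z}(L)=0$. $M$ satisfies ACC on annihilators if the set $\{\bigcap_{f\in X}\ker f\mid X\subseteq \mathrm{End}_R(M)\}$ satisfies the ascending chain condition. $M$ is a Goldie module if it satisfies ACC on annihilators and has finite uniform dimension. A submodule $K\subseteq M$ is fully invariant if $f(K)\subseteq K$ for all $f\in\mathrm{End}_R(M)$; for submodules $K,L$ of $M$, $K_ML=\sum\{f(K)\mid f\in \mathrm{Hom}_R(M,L)\}$.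 $M$ is a semiprime module if $M\neq 0$ and for every fully invariant submodule $K$ of $M$, $K_MK=0$ implies $K=0$. *)

(* Defs.v *)
From HB Require Import structures.
From mathcomp Require Import all_boot all_order all_algebra.
From mathcomp Require Import boolp classical_sets functions cardinality.

Set Implicit Arguments.
Unset Strict Implicit.
Unset Printing Implicit Defensive.

Import GRing.Theory.
Local Open Scope classical_set_scope.
Local Open Scope ring_scope.

Section Submodules.
Context {R : pzRingType}.
Implicit Types M N : lmodType R.

Record submodule M := Submodule {
  subm_set :> set M;
  subm_closed : submod_closed [in subm_set]
}.

Lemma submod_closedP M (A : set M) :
  submod_closed [in A] <->
  A 0 /\ (forall a u v, A u -> A v -> A (a *: u + v)).
Proof.
split=> [[A0 AD]|[A0 AD]]; split.
- by move: A0; rewrite inE.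
- move=> a u v Au Av.
  by have := AD a u v; rewrite !inE; apply.
- by rewrite inE.
- by move=> a u v; rewrite !inE; exact: AD.
Qed.

Definition subm_pred M (A : submodule M) : {pred M} := [in subm_set A].
HB.instance Definition _ M (A : submodule M) :=
  GRing.isSubmodClosed.Build R M (subm_pred A) (subm_closed A).

Record subm_type M (A : submodule M) : predArgType :=
  SubmType { subm_val : M; subm_valP : subm_val \in subm_pred A }.

HB.instance Definition _ M (A : submodule M) :=
  [isSub of subm_type A for @subm_val M A].
HB.instance Definition _ M (A : submodule M) :=
  [Choice of subm_type A by <:].
HB.instance Definition _ M (A : submodule M) :=
  [SubChoice_isSubZmodule of subm_type A by <:].
HB.instance Definition _ M (A : submodule M) :=
  [SubZmodule_isSubLmodule of subm_type A by <:].

Lemma setT_submod_closed M : submod_closed [in [set: M]].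
Proof. by apply/submod_closedP; split. Qed.
Definition full_submodule M := Submodule (@setT_submod_closed M).

Lemma set0_submod_closed M : submod_closed [in [set 0 : M]].
Proof.
apply/submod_closedP; split=> // a u v -> ->.
by rewrite /= scaler0 addr0.
Qed.
Definition zero_submodule M := Submodule (@set0_submod_closed M).

Lemma image_submod_closed M N (f : {linear M -> N}) (A : submodule M) :
  submod_closed [in f @` A].
Proof.
have [A0 AD] := (submod_closedP A).1 (subm_closed A).
apply/submod_closedP; split; first by exists 0; rewrite // linear0.
move=> a _ _ [u Au <-] [v Av <-].
by exists (a *: u + v); [exact: AD | rewrite linearP].
Qed.
Definition image_submodule M N (f : {linear M -> N}) (A : submodule M) :=
  Submodule (image_submod_closed f A).

Definition sum_set M (I : Type) (A : I -> submodule M) : set M :=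
  [set x | exists n (i : 'I_n -> I) (v : 'I_n -> M),
    (forall j, subm_set (A (i j)) (v j)) /\ x = \sum_(j < n) v j].

Lemma sum_submod_closed M (I : Type) (A : I -> submodule M) :
  submod_closed [in sum_set A].
Proof.
apply/submod_closedP; split.
  have i0 : 'I_0 -> I by case.
  by exists 0, i0, (fun=> 0); split; [case | rewrite big_ord0].
move=> a _ _ [m [i [u [Au ->]]]] [n [k [v [Av ->]]]].
exists (m + n)%N,
  (fun j => match fintype.split j with inl l => i l | inr l => k l end),
  (fun j => match fintype.split j with inl l => a *: u l | inr l => v l end).
split=> [j|].
  case: (fintype.split j) => l //.
  have [A0 AD] := (submod_closedP (A (i l))).1 (subm_closed _).
  by rewrite -[_ *: _]addr0; exact: AD.
rewrite big_split_ord /= scaler_sumr.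
by congr (_ + _); apply: eq_bigr => j _;
  [rewrite (unsplitK (inl j)) | rewrite (unsplitK (inr j))].
Qed.
Definition sum_submodule M (I : Type) (A : I -> submodule M) :=
  Submodule (sum_submod_closed A).

Lemma finsupp_submod_closed M (I : Type) :
  submod_closed [in [set x : I -> M | finite_set [set i | x i <> 0]]].
Proof.
apply/submod_closedP; split.
  apply: (@sub_finite_set _ _ set0); [by move=> i /=; case|exact: finite_set0].
move=> a u v fu fv.
apply: (@sub_finite_set _ _ ([set i | u i <> 0] `|` [set i | v i <> 0])).
  move=> i /= uvi; apply: contrapT => /not_orP[/contrapT ui /contrapT vi].
  by apply: uvi; rewrite /GRing.add /GRing.scale /= ui vi scaler0 addr0.
by rewrite finite_setU.
Qed.
(* The direct sum of copies of [M] indexed by [I], as the submodule of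
   finitely supported functions of the product [I -> M]. *)
Definition dsum_submodule M (I : Type) := Submodule (@finsupp_submod_closed M I).
Definition dsum M (I : Type) : lmodType R := subm_type (dsum_submodule M I).

End Submodules.

Section Modules.
Context {R : pzRingType}.
Implicit Types M N L X : lmodType R.

Definition nonzero M (A : set M) := exists2 x, A x & x <> 0.

Definition isomorphic M N := exists f : {linear M -> N}, bijective f.

Definition M_generated M X :=
  exists (I : Type) (p : {linear dsum M I -> X}), set_surj setT setT p.

Definition in_sigma M N :=
  exists X : lmodType R, M_generated M X /\
  exists A : submodule X, isomorphic N (subm_type A).

Definition short_exact (K L N : lmodType R) (f : {linear K -> L}) (g : {linear L -> N}) :=
  [/\ injective f, range f = [set x | g x = 0] & set_surj setT setT g].

(* The conclusion is the exactness of
   0 -> Hom(M, K) -> Hom(M, L) -> Hom(M, N) -> 0 at each of the three groups. *)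
Definition projective_in_sigma M :=
  forall (K L N : lmodType R) (f : {linear K -> L}) (g : {linear L -> N}),
  in_sigma M K -> in_sigma M L -> in_sigma M N -> short_exact f g ->
  [/\ forall h1 h2 : {linear M -> K}, f \o h1 =1 f \o h2 -> h1 =1 h2,
      forall h : {linear M -> L},
        (exists h' : {linear M -> K}, h =1 f \o h') <-> (forall x, g (h x) = 0)
    & forall h : {linear M -> N}, exists h' : {linear M -> L}, h =1 g \o h'].

Definition essential_in M (A B : submodule M) :=
  A `<=` B /\
  forall C : submodule M, C `<=` B -> nonzero C -> nonzero (A `&` C).

Definition essential M (A : submodule M) := essential_in A (full_submodule M).

Definition direct_summand M (A : submodule M) :=
  exists B : submodule M, A `&` B = [set 0] /\
    forall x, exists a b, [/\ subm_set A a, subm_set B b & x = a + b].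

Definition C1 M := forall A : submodule M,
  exists B : submodule M, direct_summand B /\ essential_in A B.

Definition C2 M := forall A B : submodule M,
  direct_summand B -> isomorphic (subm_type A) (subm_type B) ->
  direct_summand A.

Definition continuous_module M := C1 M /\ C2 M.

Definition retractable M := forall A : submodule M, nonzero A ->
  exists (f : {linear M -> subm_type A}) (x : M), f x <> 0.

Definition M_singular M N :=
  in_sigma M N /\
  exists (K L : lmodType R) (f : {linear K -> L}) (g : {linear L -> N}),
    [/\ in_sigma M K, in_sigma M L, short_exact f g
      & essential (image_submodule f (full_submodule K))].

Definition largest_M_singular M L (Z : submodule L) :=
  M_singular M (subm_type Z) /\
  forall A : submodule L, M_singular M (subm_type A) -> A `<=` Z.

(* [Z(L) = 0], where [Z(L)] is the largest [M]-singular submodule of [L]. *)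
Definition non_M_singular M L := largest_M_singular M (zero_submodule L).

Definition annihilators M : set (set M) :=
  [set A | exists X : set {linear M -> M},
    A = \bigcap_(f in X) [set x | f x = 0]].

Definition ACC (T : Type) (F : set (set T)) :=
  forall A : nat -> set T, (forall n, F (A n)) ->
  (forall n, A n `<=` A n.+1) ->
  exists n, forall m, (n <= m)%N -> A m = A n.

Definition uniform M (U : submodule M) :=
  nonzero U /\
  forall A B : submodule M, A `<=` U -> B `<=` U ->
    nonzero A -> nonzero B -> nonzero (A `&` B).

Definition independent M n (U : 'I_n -> submodule M) :=
  forall v : 'I_n -> M, (forall i, subm_set (U i) (v i)) ->
  \sum_(i < n) v i = 0 -> forall i, v i = 0.

Definition uniform_dimension M n :=
  exists U : 'I_n -> submodule M,
    [/\ forall i, uniform (U i), independent U & essential (sum_submodule U)].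

Definition Goldie_module M :=
  ACC (@annihilators M) /\ exists n, uniform_dimension M n.

Definition fully_invariant M (K : submodule M) :=
  forall f : {linear M -> M}, f @` K `<=` K.

(* [K_M L], the sum of the [f(K)] for [f] in [Hom(M, L)]. *)
Definition subm_product M (K L : submodule M) : submodule M :=
  sum_submodule (fun f : {linear M -> subm_type L} =>
    image_submodule (\val \o f) K).

Definition semiprime_module M :=
  nonzero [set: M] /\
  forall K : submodule M, fully_invariant K ->
    subm_product K K = [set 0] :> set M -> K = [set 0] :> set M.

End Modules.

(* Main.v *)
From HB Require Import structures.
Require Import Defs.
From mathcomp Require Import all_boot all_order all_algebra.
From mathcomp Require Import boolp classical_sets functions cardinality.

(** The proof rests on one consequence of non [M]-singularity: an endomorphism
    that vanishes on [A] vanishes on every essential extension [B] of [A] inside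
    [M], because [f(B)] is the quotient of [B] by an essential submodule and so
    is [M]-singular ([essential_vanish]).

    With (C1), let [A] be essential in a direct summand [B].  Every endomorphism
    that kills [A] kills [B], and the projection with kernel [B] kills [A]; so
    [B] is the intersection of the kernels of the endomorphisms that kill [A]
    ([annihilator_closure_summand]).  In particular [B] is an annihilator that
    is determined by [A] and monotone in [A].

    Semiprimeness.  The kernel of an endomorphism [f] is a direct summand, its
    complement is mapped isomorphically onto [f(M)], and (C2) makes [f(M)] a
    direct summand; so [End(M)] is von Neumann regular
    ([endomorphism_regular]).  If [K] is fully invariant, nonzero and
    [K_M K = 0], retractability gives a nonzero [f] with [f(M)] inside [K], and
    [f(K) = 0].  Write [f = f h f].  Since [h(f(M))] is inside [K], this gives
    [f = 0], a contradiction ([regular_semiprime]).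

    Finite uniform dimension.  The chain condition on annihilators applies to
    the closures of arbitrary submodules.  Hence every inhabited class of
    submodules has a member [P] that is essential in each larger member of the
    class, namely one with a maximal closure ([ACC_essentially_maximal]).
    Applied to the submodules that meet some nonzero submodule of [N]
    trivially, this produces a uniform submodule of [N] ([exists_uniform]);
    applied to the finite direct sums of uniform submodules, it produces an
    essential one ([finite_uniform_dimension]). *)

Local Open Scope classical_set_scope.
Local Open Scope ring_scope.

Set Implicit Arguments.
Unset Strict Implicit.
Unset Printing Implicit Defensive.
Import GRing.Theory.

(** * Submodules, restrictions and projections *)

Section SubmoduleBasics.
Context {R : pzRingType}.
Implicit Types M N U V : lmodType R.

Lemma subm0 M (A : submodule M) : subm_set A 0.
Proof. by have [] := (submod_closedP A).1 (subm_closed A). Qed.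

Lemma subm_lin M (A : submodule M) a u v :
  subm_set A u -> subm_set A v -> subm_set A (a *: u + v).
Proof. by have [_] := (submod_closedP A).1 (subm_closed A); apply. Qed.

Lemma submD M (A : submodule M) u v :
  subm_set A u -> subm_set A v -> subm_set A (u + v).
Proof. by move=> Au Av; rewrite -[u]scale1r; exact: subm_lin. Qed.

Lemma submN M (A : submodule M) u : subm_set A u -> subm_set A (- u).
Proof.
by move=> Au; rewrite -scaleN1r -[_ *: _]addr0; apply: subm_lin (subm0 A).
Qed.

Lemma submB M (A : submodule M) u v :
  subm_set A u -> subm_set A v -> subm_set A (u - v).
Proof. by move=> Au Av; apply: submD => //; exact: submN. Qed.

Lemma subm_val_in M (A : submodule M) (a : subm_type A) : subm_set A (val a).
Proof. by have := subm_valP a; rewrite inE. Qed.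

Lemma subm_val_onto M (A : submodule M) x :
  subm_set A x -> exists a : subm_type A, val a = x.
Proof.
move=> Ax; have Ax' : x \in subm_pred A by apply: mem_set.
by exists (SubmType Ax').
Qed.

(** Maps into a [subm_type] carry membership proofs, so restrictions,
    projections onto summands and inverses of injective maps are awkward to
    write down.  Each of them is easily described by its graph, and this lemma
    turns such a graph into a linear map. *)
Lemma linear_of_relation U V (Q : U -> V -> Prop) :
  (forall u, exists v, Q u v) ->
  (forall u v w, Q u v -> Q u w -> v = w) ->
  (forall a u u' v v', Q u v -> Q u' v' -> Q (a *: u + u') (a *: v + v')) ->
  exists f : {linear U -> V}, forall u, Q u (f u).
Proof.
move=> /choice[f Qf] Qfun Qlin.
have f_lin : linear f.
  by move=> a u v; apply: Qfun (Qf _) _; apply: Qlin; exact: Qf.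
pose m := GRing.isLinear.Build R U V *:%R f f_lin.
pose F : {linear U -> V} := HB.pack f m.
by exists F.
Qed.

Lemma kernel_submod_closed M N (f : {linear M -> N}) (A : submodule M) :
  submod_closed [in A `&` [set x | f x = 0]].
Proof.
apply/submod_closedP; split; first by split; [exact: subm0|exact: linear0].
move=> a u v [Au fu] [Av fv]; split; first exact: subm_lin.
by rewrite /= linearP fu fv scaler0 addr0.
Qed.
Definition kernel_in M N (f : {linear M -> N}) (A : submodule M) :=
  Submodule (kernel_submod_closed f A).

Lemma add_submod_closed M (A B : submodule M) :
  submod_closed [in [set x | exists a b,
    [/\ subm_set A a, subm_set B b & x = a + b]]].
Proof.
apply/submod_closedP; split.
  by exists 0, 0; split; rewrite ?addr0 //; exact: subm0.
move=> c _ _ [a [b [Aa Bb ->]]] [a' [b' [Aa' Bb' ->]]].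
exists (c *: a + a'), (c *: b + b'); split; try exact: subm_lin.
by rewrite scalerDr addrACA.
Qed.
Definition add_submodule M (A B : submodule M) :=
  Submodule (add_submod_closed A B).

Lemma restriction M N (f : {linear M -> N}) (A : submodule M)
    (B : submodule N) :
  (forall x, subm_set A x -> subm_set B (f x)) ->
  exists g : {linear subm_type A -> subm_type B},
    forall a, val (g a) = f (val a).
Proof.
move=> fAB.
apply: (@linear_of_relation _ _ (fun a b => val b = f (val a))).
- by move=> a; apply: subm_val_onto; apply: fAB; exact: subm_val_in.
- by move=> a b c <- /val_inj.
- by move=> c a a' b b' /= eb eb'; rewrite !linearP /= eb eb'.
Qed.

Lemma summand_projection M (A : submodule M) : direct_summand A ->
  exists p : {linear M -> subm_type A}, forall a, p (val a) = a.
Proof.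
move=> [B [AB0 ABT]].
have inj a (b : subm_type A) : subm_set B (val a - val b) -> a = b.
  move=> Bab; apply/val_inj/eqP; rewrite -subr_eq0; apply/eqP.
  suff : (A `&` B) (val a - val b) by rewrite AB0.
  by split=> //; apply: submB; exact: subm_val_in.
have [||c u u' v v' Bu Bu'|p Bp] :=
  @linear_of_relation M (subm_type A) (fun x a => subm_set B (x - val a)).
- move=> x; have [a [b [Aa Bb ->]]] := ABT x.
  by have [a' <-] := subm_val_onto Aa; exists a'; rewrite addrC addKr.
- move=> x a b Ba Bb; apply: inj.
  have -> : val a - val b = (x - val b) - (x - val a).
    by rewrite opprB [RHS]addrC addrA subrK.
  exact: submB.
- by rewrite linearP addrACA -scalerDr; exact: subm_lin.
by exists p => a; apply/esym/inj/Bp.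
Qed.

End SubmoduleBasics.

(** * Consequences of non M-singularity, (C1) and (C2) *)

Section NonsingularCS.
Context {R : pzRingType}.
Implicit Types M : lmodType R.

(** [M] itself is [M]-generated, as the direct sum of one copy of [M], which
    is indexed here by [unit]. *)
Lemma submodule_in_sigma M (A : submodule M) : in_sigma M (subm_type A).
Proof.
exists M; split; last by exists A, idfun; exists idfun.
have [||c u u' v v' <- <-|p pE] :=
  @linear_of_relation R (dsum M unit) M (fun x y => val x tt = y).
- by move=> x; exists (val x tt).
- by move=> x y z <-.
- by rewrite linearP.
exists unit, p; move=> x _ /=.
have [|y yE] := @subm_val_onto _ _ (dsum_submodule M unit) (fun=> x).
  exact: finite_finset.
by exists y; rewrite // -pE yE.
Qed.

(** The sequence [0 -> ker f `&` B -> B -> f(B) -> 0] has an essential left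
    term, since [ker f `&` B] contains [A]; so [f(B)] is an [M]-singular
    submodule of [M] and must vanish. *)
Lemma essential_vanish M (f : {linear M -> M}) (A B : submodule M) :
  non_M_singular M M -> essential_in A B ->
  (forall x, subm_set A x -> f x = 0) -> forall x, subm_set B x -> f x = 0.
Proof.
move=> [_ sing0] [AB essAB] fA0 x Bx.
pose K := kernel_in f B; pose N := image_submodule f B.
suff : N `<=` zero_submodule M by apply; exists x.
apply: sing0; split; first exact: submodule_in_sigma.
have [i iE] : exists i : {linear subm_type K -> subm_type B},
  forall a, val (i a) = val a by apply: (@restriction _ _ _ idfun) => y [].
have [g gE] : exists g : {linear subm_type B -> subm_type N},
  forall a, val (g a) = f (val a) by apply: restriction => y By; exists y.
exists (subm_type K), (subm_type B), i, g.
split; [exact: submodule_in_sigma|exact: submodule_in_sigma|split|].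
- by move=> a b eab; apply: val_inj; rewrite -!iE eab.
- apply/seteqP; split=> [_ [a _ <-]|b /= gb0].
    apply: val_inj; rewrite gE iE.
    by have [_ ->] := subm_val_in a; rewrite linear0.
  have [|a aE] := @subm_val_onto _ _ K (val b).
    by split; [exact: subm_val_in|rewrite /= -gE gb0 linear0].
  by exists a => //; apply: val_inj; rewrite iE.
- move=> y _; have [b Bb fb] := subm_val_in y.
  have [b' b'E] := subm_val_onto Bb.
  by exists b' => //; apply: val_inj; rewrite gE b'E.
split=> // C _ [c Cc c0].
(* [C] lives inside the type of [B]; essentiality of [A] is used in [M]. *)
have [] := essAB (image_submodule (val : {linear subm_type B -> M}) C).
- by move=> _ [b _ <-]; exact: subm_val_in.
- exists (val c); first by exists c.
  by move=> vc0; apply: c0; apply: val_inj; rewrite vc0 linear0.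
move=> y [Ay [b Cb vb]] y0; rewrite -{}vb in Ay y0.
exists b; last by move=> eb; apply: y0; rewrite eb linear0.
split=> //; have [|a aE] := @subm_val_onto _ _ K (val b).
  by split; [exact: subm_val_in|exact: fA0].
by exists a => //; apply: val_inj; rewrite iE.
Qed.

(** Of the annihilators in the sense of [annihilators], this is the smallest
    one that contains [A]. *)
Definition annihilator_closure M (A : set M) : set M :=
  \bigcap_(f in [set f : {linear M -> M} | A `<=` [set x | f x = 0]])
    [set x | f x = 0].

Lemma annihilator_closureS M (A B : set M) :
  A `<=` B -> annihilator_closure A `<=` annihilator_closure B.
Proof. by move=> AB x clx f fB; apply: clx => y /AB /fB. Qed.

Lemma sub_annihilator_closure M (A : set M) : A `<=` annihilator_closure A.
Proof. by move=> x Ax f; apply. Qed.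

(** The closure is thus an essential extension of [A] that is monotone in
    [A]: ascending chains of submodules become ascending chains of annihilators
    without losing essential information. *)
Lemma annihilator_closure_summand M (A : submodule M) :
  C1 M -> non_M_singular M M ->
  exists B : submodule M,
    [/\ direct_summand B, essential_in A B & annihilator_closure A = B].
Proof.
move=> c1 ns; have [B [sB eAB]] := c1 A; exists B; split=> //.
apply/seteqP; split=> [x clx|x Bx f fA]; last first.
  exact: (essential_vanish ns eAB fA).
have [p pE] := summand_projection sB.
(* [q] is the projection with kernel [B]; it is one of the maps that kill [A]. *)
have [q qE] : exists q : {linear M -> M}, forall x, q x = x - val (p x).
  apply: (@linear_of_relation _ _ _ (fun x y => y = x - val (p x))).
  - by move=> y; exists (y - val (p y)).
  - by move=> u v w -> ->.
  - by move=> c u u' v v' -> ->; rewrite !linearP addrACA -scalerDr.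
suff : q x = 0 by rewrite qE => /subr0_eq ->; exact: subm_val_in.
apply: clx => y Ay; have [b <-] := subm_val_onto (eAB.1 _ Ay).
by rewrite /= qE pE subrr.
Qed.

(** A summand in which the kernel is essential is itself killed by [f], so it
    equals the kernel; its complement is then a copy of the image of [f]. *)
Lemma kernel_complement M (f : {linear M -> M}) :
  C1 M -> non_M_singular M M ->
  exists C : submodule M, [/\ direct_summand C,
    forall c, subm_set C c -> f c = 0 -> c = 0
    & forall x, exists2 c, subm_set C c & f c = f x].
Proof.
move=> c1 ns; pose K := kernel_in f (full_submodule M).
have [B [[C [BC0 BCT]] eKB]] := c1 K.
have fB0 := essential_vanish ns eKB (fun x (Kx : subm_set K x) => Kx.2).
exists C; split.
- exists B; split; first by rewrite setIC.
  move=> x; have [b [c [Bb Cc ->]]] := BCT x.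
  by exists c, b; split; rewrite // addrC.
- move=> c Cc fc0; suff : (B `&` C) c by rewrite BC0.
  by split=> //; apply: eKB.1.
move=> x; have [b [c [Bb Cc ->]]] := BCT x.
by exists c; rewrite // linearD (fB0 b Bb) add0r.
Qed.

(** The quasi-inverse [h] projects onto the summand [f(M)], then inverts the
    isomorphism [f : C -> f(M)] on a complement [C] of the kernel. *)
Lemma endomorphism_regular M (f : {linear M -> M}) :
  continuous_module M -> non_M_singular M M ->
  exists h : {linear M -> M}, forall x, f (h (f x)) = f x.
Proof.
move=> [c1 c2] ns; have [C [sC Cinj Consto]] := kernel_complement f c1 ns.
pose A := image_submodule f C.
have injC (c d : subm_type C) : f (val c) = f (val d) -> c = d.
  move=> fcd; apply/val_inj/eqP; rewrite -subr_eq0; apply/eqP.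
  apply: Cinj; first by apply: submB; exact: subm_val_in.
  by rewrite linearB /= fcd subrr.
have [||a u u' v v' /= eu eu'|phi phiE] :=
  @linear_of_relation _ _ _ (fun (a : subm_type A) (c : subm_type C) =>
                               f (val c) = val a).
- move=> a; have [c Cc fc] := subm_val_in a.
  by have [c' c'E] := subm_val_onto Cc; exists c'; rewrite c'E.
- by move=> a c d ca da; apply: injC; rewrite ca da.
- by rewrite !linearP /= eu eu'.
have [psi psiE] : exists psi : {linear subm_type C -> subm_type A},
  forall c, val (psi c) = f (val c) by apply: restriction => c Cc; exists c.
have sA : direct_summand A.
  apply: (c2 A C) => //; exists phi, psi => [a|c].
    by apply: val_inj; rewrite psiE phiE.
  by apply: injC; rewrite phiE psiE.
have [p pE] := summand_projection sA.
pose h : {linear M -> M} := (val : {linear subm_type C -> M}) \o (phi \o p).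
exists h => x; have [c Cc <-] := Consto x.
have [a <-] : exists a : subm_type A, val a = f c.
  by apply: subm_val_onto; exists c.
by rewrite /h /= pE phiE.
Qed.

Lemma not_nonzero M (A : submodule M) : ~ nonzero A -> A = [set 0] :> set M.
Proof.
move=> nA; apply/seteqP; split=> [x Ax|_ ->]; last exact: subm0.
by apply: contrapT => x0; apply: nA; exists x.
Qed.

(** When [K_M K = 0], a map [f0 : M -> K] kills [K].  For a quasi-inverse [h] of
    [f0], the element [h (f0 x)] lies in [K] by full invariance, so
    [f0 x = f0 (h (f0 x)) = 0]. *)
Lemma regular_semiprime M :
  nonzero [set: M] -> retractable M ->
  (forall f : {linear M -> M},
     exists h : {linear M -> M}, forall x, f (h (f x)) = f x) ->
  semiprime_module M.
Proof.
move=> M0 retr reg; split=> // K invK KK0; apply: not_nonzero => K0.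
have [f0 [x f0x]] := retr K K0; apply: f0x.
pose f : {linear M -> M} := (val : {linear subm_type K -> M}) \o f0.
have [h fhf] := reg f.
have fK0 y : subm_set K y -> f y = 0.
  move=> Ky; suff : subm_set (subm_product K K) (f y) by rewrite KK0.
  exists 1%N, (fun=> f0), (fun=> f y); rewrite big_ord1; split=> // _.
  by exists y.
apply: val_inj; rewrite -[val _]/(f x) linear0 -fhf; apply: fK0.
by apply: invK; exists (f x) => //; exact: subm_val_in.
Qed.

End NonsingularCS.

(** * Finite uniform dimension from the chain condition *)

Section FiniteUniformDimension.
Context {R : pzRingType}.
Implicit Types M : lmodType R.

Lemma annihilator_closure_annihilator M (A : set M) :
  @annihilators R M (annihilator_closure A).
Proof. by exists [set f : {linear M -> M} | A `<=` [set x | f x = 0]]. Qed.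

(** The maximal condition is stated for an indexed family because it is applied
    to closures of submodules, and the submodule is needed besides its
    closure. *)
Lemma ACC_maximal (T : Type) (F : set (set T)) (I : Type) (P : I -> Prop)
    (c : I -> set T) i0 :
  ACC F -> (forall i, F (c i)) -> P i0 ->
  exists i, P i /\ forall j, P j -> c i `<=` c j -> c j `<=` c i.
Proof.
move=> acc Fc Pi0; apply: contrapT => nomax.
have next (i : {i | P i}) : exists j : {j | P j},
    c (sval i) `<=` c (sval j) /\ ~ c (sval j) `<=` c (sval i).
  apply: contrapT => nonext; apply: nomax; exists (sval i).
  split=> [|j Pj cij]; first exact: svalP.
  by apply: contrapT => ncji; apply: nonext; exists (exist _ j Pj).
have [s sP] := choice next.
pose u n := iter n s (exist _ i0 Pi0).
have [||n un] := acc (fun n => c (sval (u n))).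
- by move=> n; exact: Fc.
- by move=> n; exact: (sP (u n)).1.
by apply: (sP (u n)).2; rewrite -(un n.+1).
Qed.

(** Take [P] with a maximal closure.  A larger member [P'] of the class has the
    same closure, so [P `<=` P' `<=` cl P], and [P] is essential in [cl P]. *)
Lemma ACC_essentially_maximal M (G : submodule M -> Prop) P0 :
  C1 M -> non_M_singular M M -> ACC (@annihilators R M) -> G P0 ->
  exists P, G P /\ forall P' C : submodule M, G P' -> P `<=` P' -> C `<=` P' ->
    nonzero C -> nonzero (P `&` C).
Proof.
move=> c1 ns acc GP0.
have [P [GP Pmax]] := ACC_maximal acc
  (fun A : submodule M => annihilator_closure_annihilator A) GP0.
exists P; split=> // P' C GP' PP' CP' C0.
have [B [_ [_ essPB] clPE]] := annihilator_closure_summand P c1 ns.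
apply: essPB => //; rewrite -clPE => x /CP' /sub_annihilator_closure clx.
by apply: (Pmax P' GP' _ x clx); exact: annihilator_closureS.
Qed.

(** Let [P] be essentially maximal among the submodules that meet some nonzero
    [B `<=` N] trivially.  If [B] contained nonzero [A] and [A'] with zero
    intersection, then [P + A] would still meet [A'] trivially, although [P] is
    not essential in [P + A]. *)
Lemma exists_uniform M (N : submodule M) :
  C1 M -> non_M_singular M M -> ACC (@annihilators R M) -> nonzero N ->
  exists U : submodule M, uniform U /\ U `<=` N.
Proof.
move=> c1 ns acc N0.
pose G (P : submodule M) := exists B : submodule M,
  [/\ B `<=` N, nonzero B & ~ nonzero (P `&` B)].
have G0 : G (zero_submodule M).
  by exists N; split=> // -[x [/= ->]].
have [P [[B [BN B0 PB0]] Pmax]] := ACC_essentially_maximal c1 ns acc G0.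
exists B; split=> //; split=> // A A' AB A'B A0 A'0.
apply: contrapT => AA'0.
have PA_A'0 : G (add_submodule P A).
  exists A'; split=> //; first by move=> x /A'B /BN.
  move=> [_ [[p [a [Pp Aa ->]]] A'pa] pa0].
  have p0 : p = 0.
    apply: contrapT => pn0; apply: PB0; exists p => //; split=> //.
    by rewrite -[p](addrK a); apply: submB; [exact: A'B|exact: AB].
  apply: AA'0; exists (p + a) => //; split=> //.
  by rewrite p0 add0r.
have [|x Ax|x [Px Ax] x0] := Pmax _ A PA_A'0 _ _ A0.
- move=> x Px; exists x, 0; rewrite addr0; split=> //; exact: subm0.
- by exists 0, x; rewrite add0r; split=> //; exact: subm0.
by apply: PB0; exists x => //; split=> //; exact: AB.
Qed.

Lemma independent_extend M n (U : 'I_n -> submodule M) (V : submodule M) :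
  independent U -> ~ nonzero (sum_submodule U `&` V) ->
  independent (fun i : 'I_n.+1 => if unlift ord0 i is Some j then U j else V).
Proof.
move=> indU UV0 v; set W := fun i => _ => Wv; rewrite big_ord_recl => sum0.
have Vv : subm_set V (v ord0) by have := Wv ord0; rewrite /W unlift_none.
have Uv j : subm_set (U j) (v (lift ord0 j)).
  by have := Wv (lift ord0 j); rewrite /W liftK.
have v0 : v ord0 = 0.
  apply: contrapT => v0; apply: UV0; exists (v ord0) => //; split=> //.
  rewrite -[v ord0]opprK; apply: submN.
  exists n, id, (fun j => v (lift ord0 j)); split=> //.
  by apply/eqP; rewrite eq_sym -addr_eq0 addrC; apply/eqP.
move=> i; case: (unliftP ord0 i) => [j ->|-> //].
by move: sum0; rewrite v0 add0r => /(indU (fun j => v (lift ord0 j)) Uv) ->.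
Qed.

(** If an essentially maximal direct sum of uniform submodules missed a nonzero
    [C], a uniform submodule of [C] could be added to it as a new summand. *)
Lemma finite_uniform_dimension M :
  C1 M -> non_M_singular M M -> ACC (@annihilators R M) ->
  exists n, uniform_dimension M n.
Proof.
move=> c1 ns acc.
pose G (P : submodule M) := exists n (U : 'I_n -> submodule M),
  [/\ forall i, uniform (U i), independent U & P = sum_submodule U].
have G0 : G (sum_submodule (fun _ : 'I_0 => zero_submodule M)).
  by exists 0%N, (fun=> zero_submodule M); split=> // [[]|v _ _ []].
have [_ [[n [U [unifU indU ->]]] Pmax]] :=
  ACC_essentially_maximal c1 ns acc G0.
exists n, U; split=> //; split=> // C _ C0; apply: contrapT => UC0.
have [V [unifV VC]] := exists_uniform c1 ns acc C0.
have UV0 : ~ nonzero (sum_submodule U `&` V).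
  by move=> [x [Ux Vx] x0]; apply: UC0; exists x => //; split=> //; exact: VC.
pose W (i : 'I_n.+1) := if unlift ord0 i is Some j then U j else V.
have GW : G (sum_submodule W).
  exists n.+1, W; split=> //; last exact: independent_extend.
  by move=> i; rewrite /W; case: unlift.
apply: UV0; apply: (Pmax _ V GW) unifV.1.
  move=> _ [m [i [v [Uv ->]]]].
  exists m, (fun j => lift ord0 (i j)), v; split=> // j.
  by rewrite /W liftK.
move=> x Vx; exists 1%N, (fun=> ord0), (fun=> x); rewrite big_ord1.
by split=> // _; rewrite /W unlift_none.
Qed.

End FiniteUniformDimension.

Theorem theorem3p6 (R : pzRingType) (M : lmodType R) :
  nonzero [set: M] ->
  projective_in_sigma M ->
  continuous_module M ->
  retractable M ->
  non_M_singular M M ->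
  ACC (@annihilators R M) ->
  semiprime_module M /\ Goldie_module M.
Proof.
move=> M0 _ cont retr ns acc; split.
  by apply: regular_semiprime => // f; exact: endomorphism_regular.
by split=> //; exact: finite_uniform_dimension cont.1 ns acc.
Qed.
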